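(* Let $\mathbb F$ be a field and let $k_0,k_1,k^\vee_0,k^\vee_1,q$ be nonzero scalars in $\mathbb F$. In the algebra $H(k_0,k_1,k^\vee_0,k^\vee_1;q)$ define $$x = t^\vee_0 t_1 + (t^\vee_0 t_1)^{-1},\qquad y = t^\vee_1 t_1 + (t^\vee_1 t_1)^{-1},\qquad z = t_0 t_1 + (t_0 t_1)^{-1}.$$ Then the following (i)--(iv) hold. (i) $t_1$ commutes with each of $x$, $y$, $z$. (ii) Assume $q^2=1$. Then $x$, $y$, $z$ mutually commute. (iii) Assume $q^2\neq 1$ and $q^4=1$. Then $\mathrm{Char}(\mathbb F)\neq 2$ and $$\frac{xy+yx}{2} = (k^\vee_0+k^{\vee -1}_0)(k^\vee_1+k^{\vee -1}_1)+(k_0+k^{-1}_0)(q^{-1}t_1+qt^{-1}_1),$$ $$\frac{yz+zy}{2} = (k^\vee_1+k^{\vee -1}_1)(k_0+k^{-1}_0)+(k^\vee_0+k^{\vee -1}_0)(q^{-1}t_1+qt^{-1}_1),$$ $$\frac{zx+xz}{2} = (k_0+k^{-1}_0)(k^\vee_0+k^{\vee -1}_0)+(k^\vee_1+k^{\vee -1}_1)(q^{-1}t_1+qt^{-1}_1).$$ (iv) Assume $q^4\neq 1$. Then $$\frac{qxy-q^{-1}yx}{q^2-q^{-2}}+z = \frac{(k^\vee_0+k^{\vee -1}_0)(k^\vee_1+k^{\vee -1}_1)+(k_0+k^{-1}_0)(q^{-1}t_1+qt^{-1}_1)}{q+q^{-1}},$$ $$\frac{qyz-q^{-1}zy}{q^2-q^{-2}}+x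 = \frac{(k^\vee_1+k^{\vee -1}_1)(k_0+k^{-1}_0)+(k^\vee_0+k^{\vee -1}_0)(q^{-1}t_1+qt^{-1}_1)}{q+q^{-1}},$$ $$\frac{qzx-q^{-1}xz}{q^2-q^{-2}}+y = \frac{(k_0+k^{-1}_0)(k^\vee_0+k^{\vee -1}_0)+(k^\vee_1+k^{\vee -1}_1)(q^{-1}t_1+qt^{-1}_1)}{q+q^{-1}}.$$
   Context: All algebras are associative with $1$. For a field $\mathbb F$ and nonzero scalars $k_0,k_1,k^\vee_0,k^\vee_1,q\in\mathbb F$, $H(k_0,k_1,k^\vee_0,k^\vee_1;q)$ denotes the $\mathbb F$-algebra defined by generators $t_i$, $t^\vee_i$ $(i=0,1)$ and relations $$(t_i-k_i)(t_i-k_i^{-1})=0,\qquad (t^\vee_i-k^\vee_i)(t^\vee_i-k^{\vee -1}_i)=0\quad (i=0,1),\qquad t^\vee_0t_0t^\vee_1t_1=q^{-1}.$$ It is the double affine Hecke algebra of type $(C_1^\vee,C_1)$. In it the elements $t_i$, $t_i^\vee$ are invertible, with $t_i+t_i^{-1}=k_i+k_i^{-1}$ and $t^\vee_i+t^{\vee -1}_i=k^\vee_i+k^{\vee -1}_i$. Notation: $k^{\vee -1}_i=(k^\vee_i)^{-1}$ and $t^{\vee -1}_i=(t^\vee_i)^{-1}$. *)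

(* Defs.v *)
From HB Require Import structures.
From mathcomp Require Import all_boot all_order all_algebra.
From mathcomp Require Import finmap boolp monalg.
From mathcomp Require Import ring.

Set Implicit Arguments.
Unset Strict Implicit.
Unset Printing Implicit Defensive.

Import GRing.Theory.
Local Open Scope ring_scope.
Local Open Scope quotient_scope.

(* Quotient of a ring by the two-sided ideal generated by a set S.            *)
(* The ideal may be improper, so only a possibly trivial ring is obtained.    *)
Inductive ideal_gen (A : nzRingType) (S : A -> Prop) : A -> Prop :=
| ideal_gen_base a r b of S r : ideal_gen S (a * r * b)
| ideal_gen0 : ideal_gen S 0
| ideal_genB u v of ideal_gen S u & ideal_gen S v : ideal_gen S (u - v).

Section QuotientRing.
Variables (A : nzRingType) (S : A -> Prop).

Lemma ideal_genMl a u : ideal_gen S u -> ideal_gen S (a * u).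
Proof.
elim=> [a' r b Sr||u1 u2 _ h1 _ h2].
- by rewrite !mulrA; apply: ideal_gen_base.
- by rewrite mulr0; apply: ideal_gen0.
- by rewrite mulrBr; apply: ideal_genB.
Qed.

Lemma ideal_genMr b u : ideal_gen S u -> ideal_gen S (u * b).
Proof.
elim=> [a r b' Sr||u1 u2 _ h1 _ h2].
- by rewrite -mulrA; apply: ideal_gen_base.
- by rewrite mul0r; apply: ideal_gen0.
- by rewrite mulrBl; apply: ideal_genB.
Qed.

Definition ideal_pred : pred A := fun a => `[< ideal_gen S a >].

Lemma ideal_pred_zmod_closed : zmod_closed ideal_pred.
Proof.
split=> [|u v]; first by apply/asboolP; apply: ideal_gen0.
by move=> /asboolP hu /asboolP hv; apply/asboolP; apply: ideal_genB.
Qed.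

HB.instance Definition _ :=
  GRing.isZmodClosed.Build A ideal_pred ideal_pred_zmod_closed.

Definition ring_quot := Quotient.quot (GRing.ZmodClosed.clone A ideal_pred _).
HB.instance Definition _ := GRing.Zmodule.on ring_quot.

(* Projection and product are locked to prevent their unfolding during        *)
(* conversion.                                                                *)
Fact rq_key : unit. Proof. exact: tt. Qed.
Definition rq_pi : A -> ring_quot :=
  locked_with rq_key (fun a => \pi_ring_quot a).
Lemma rq_piE a : rq_pi a = \pi_ring_quot a.
Proof. by rewrite /rq_pi unlock. Qed.

Lemma rq_pi_eq a b : (rq_pi a = rq_pi b) <-> ideal_gen S (a - b).
Proof.
split.
  move=> /eqP; rewrite !rq_piE -Quotient.idealrBE => h.
  exact/asboolP.
by move=> h; apply/eqP; rewrite !rq_piE -Quotient.idealrBE; apply/asboolP.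
Qed.

Lemma rq_surj (P : ring_quot -> Prop) : (forall a, P (rq_pi a)) -> forall u, P u.
Proof. by move=> h u; rewrite -[u]reprK -rq_piE; apply: h. Qed.

Lemma rq_piD : {morph rq_pi : a b / a + b}.
Proof. by move=> a b; rewrite !rq_piE piE. Qed.

Lemma rq_repr a : ideal_gen S (repr (rq_pi a) - a).
Proof. by apply/rq_pi_eq; rewrite rq_piE reprK. Qed.

Definition rq_one : ring_quot := rq_pi 1.
Definition rq_mul : ring_quot -> ring_quot -> ring_quot :=
  locked_with rq_key (fun u v => rq_pi (repr u * repr v)).

Lemma rq_piM a b : rq_mul (rq_pi a) (rq_pi b) = rq_pi (a * b).
Proof.
rewrite /rq_mul unlock.
apply/rq_pi_eq; set a' := repr _; set b' := repr _.
have -> : a' * b' - a * b = a' * (b' - b) - (a - a') * b.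
  by rewrite mulrBr mulrBl opprB addrA subrK.
apply: ideal_genB; first by apply/ideal_genMl/rq_repr.
by apply: ideal_genMr; rewrite -opprB -sub0r; apply: ideal_genB;
  [apply: ideal_gen0 | apply: rq_repr].
Qed.

Fact rq_mulA : associative rq_mul.
Proof.
elim/rq_surj=> a; elim/rq_surj=> b; elim/rq_surj=> c.
by rewrite !rq_piM mulrA.
Qed.
Fact rq_mul1 : left_id rq_one rq_mul.
Proof. by elim/rq_surj=> a; rewrite rq_piM mul1r. Qed.
Fact rq_mulr1 : right_id rq_one rq_mul.
Proof. by elim/rq_surj=> a; rewrite rq_piM mulr1. Qed.
Fact rq_mulDl : left_distributive rq_mul +%R.
Proof.
elim/rq_surj=> a; elim/rq_surj=> b; elim/rq_surj=> c.
by rewrite -rq_piD !rq_piM mulrDl rq_piD.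
Qed.
Fact rq_mulDr : right_distributive rq_mul +%R.
Proof.
elim/rq_surj=> a; elim/rq_surj=> b; elim/rq_surj=> c.
by rewrite -rq_piD !rq_piM mulrDr rq_piD.
Qed.

HB.instance Definition _ := GRing.Zmodule_isPzRing.Build ring_quot
  rq_mulA rq_mul1 rq_mulr1 rq_mulDl rq_mulDr.

Lemma rq_pi_is_zmod_morphism : zmod_morphism rq_pi.
Proof.
move=> a b; apply/(addIr (rq_pi b)).
by rewrite -rq_piD !subrK.
Qed.
HB.instance Definition _ :=
  GRing.isZmodMorphism.Build A ring_quot rq_pi rq_pi_is_zmod_morphism.
Lemma rq_pi_is_monoid_morphism : monoid_morphism rq_pi.
Proof. by split=> // a b; rewrite -rq_piM. Qed.
HB.instance Definition _ :=
  GRing.isMonoidMorphism.Build A ring_quot rq_pi rq_pi_is_monoid_morphism.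

Lemma rq_one_neq0 : ~ ideal_gen S 1 -> (1 : ring_quot) != 0.
Proof.
move=> h; apply/eqP => e; apply: h.
have -> : (1 : A) = 1 - 0 by rewrite subr0.
by apply/rq_pi_eq; rewrite rmorph1 rmorph0.
Qed.

End QuotientRing.
Arguments rq_pi {A} S a.

Section QuotientAlgebra.
Variables (F : fieldType) (A : algType F) (S : A -> Prop).

(* An algebra over F, except that 1 != 0 may fail: hence no algType yet.      *)
Definition alg_quot := ring_quot S.
HB.instance Definition _ := GRing.PzRing.on alg_quot.

Definition aq_scale (c : F) (u : alg_quot) : alg_quot := rq_pi S c%:A * u.

Lemma aq_scaleE c a : aq_scale c (rq_pi S a) = rq_pi S (c *: a).
Proof. by rewrite /aq_scale -rmorphM mulr_algl. Qed.

Fact aq_scaleA c d u : aq_scale c (aq_scale d u) = aq_scale (c * d) u.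
Proof. by elim/rq_surj: u => a; rewrite !aq_scaleE scalerA. Qed.
Fact aq_scale1 : left_id 1 aq_scale.
Proof. by elim/rq_surj=> a; rewrite !aq_scaleE scale1r. Qed.
Fact aq_scaleDr : right_distributive aq_scale +%R.
Proof. by move=> c u v; rewrite /aq_scale mulrDr. Qed.
Fact aq_scaleDl u : {morph aq_scale^~ u : c d / c + d}.
Proof. by move=> c d; rewrite /aq_scale scalerDl rmorphD mulrDl. Qed.
HB.instance Definition _ := GRing.Zmodule_isLmodule.Build F alg_quot
  aq_scaleA aq_scale1 aq_scaleDr aq_scaleDl.

Fact aq_scaleAl c (u v : alg_quot) : c *: (u * v) = (c *: u) * v.
Proof. exact: mulrA. Qed.
Fact aq_scaleAr c (u v : alg_quot) : c *: (u * v) = u * (c *: v).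
Proof.
elim/rq_surj: u => a; elim/rq_surj: v => b; rewrite -rmorphM.
by rewrite /GRing.scale /= !aq_scaleE -rmorphM scalerAr.
Qed.

Lemma rq_piA c : rq_pi S c%:A = c *: (1 : alg_quot).
Proof. by rewrite -aq_scaleE. Qed.

Lemma rq_pi_rel a : S a -> rq_pi S a = 0.
Proof.
move=> Sa; rewrite -(rmorph0 (rq_pi S)); apply/rq_pi_eq.
by rewrite subr0 -[a]mulr1 -[a]mul1r; apply: ideal_gen_base.
Qed.

Lemma aq_quad k l t (u : alg_quot := rq_pi S t) (e : alg_quot := 1) :
  S ((t - k%:A) * (t - l%:A)) -> (u - k *: e) * (u - l *: e) = 0.
Proof. by move=> /rq_pi_rel; rewrite rmorphM !rmorphB /= !rq_piA. Qed.

Lemma aq_prod4 c t1 t2 t3 t4 :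
  S (t1 * t2 * t3 * t4 - c%:A) ->
  rq_pi S t1 * rq_pi S t2 * rq_pi S t3 * rq_pi S t4 = c *: (1 : alg_quot).
Proof.
by move=> /rq_pi_rel; rewrite rmorphB !rmorphM /= rq_piA => /subr0_eq.
Qed.

End QuotientAlgebra.

Lemma malg_scalerAr (F : fieldType) (M : monomType) (c : F) (a b : {malg F[M]}) :
  c *: (a * b) = a * (c *: b).
Proof.
apply/malgP => k; rewrite mcoeffZ (mcoeffMlw k (fsubset_refl _) (msuppZ_le c b)).
rewrite (mcoeffMlw k (fsubset_refl _) (fsubset_refl _)) mulr_sumr.
apply: eq_bigr => k1 _; rewrite mulr_sumr; apply: eq_bigr => k2 _.
by rewrite mcoeffZ mulrnAr mulrCA.
Qed.

Section FreeAlgebra.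
Variables (F : fieldType) (I : choiceType).

Definition free_alg := {malg F[{fmonom I}]}.
HB.instance Definition _ := GRing.Lalgebra.on free_alg.
Definition free_gen (i : I) : free_alg := << fmu i >>.

HB.instance Definition _ :=
  GRing.Lalgebra_isAlgebra.Build F free_alg (@malg_scalerAr F _).

End FreeAlgebra.

Section ClassicalInverse.
Variable R : nzRingType.

Definition cl_unit : pred R := fun u => `[< exists v, v * u = 1 /\ u * v = 1 >].
Definition cl_inv (u : R) : R :=
  if pselect (exists v, v * u = 1 /\ u * v = 1) is left h
  then projT1 (cid h) else u.

Fact cl_mulVr : {in cl_unit, left_inverse 1 cl_inv *%R}.
Proof.
move=> u /asboolP h; rewrite /cl_inv; case: pselect => // h'.
by case: (cid h') => v [].
Qed.
Fact cl_divrr : {in cl_unit, right_inverse 1 cl_inv *%R}.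
Proof.
move=> u /asboolP h; rewrite /cl_inv; case: pselect => // h'.
by case: (cid h') => v [].
Qed.
Fact cl_unitrP (u v : R) : v * u = 1 /\ u * v = 1 -> cl_unit u.
Proof. by move=> h; apply/asboolP; exists v. Qed.
Fact cl_invr_out : {in [predC cl_unit], cl_inv =1 id}.
Proof. by move=> u /asboolPn h; rewrite /cl_inv; case: pselect. Qed.

End ClassicalInverse.

Lemma quad_inv (F : fieldType) (A : algType F) (k : F) (t : A) :
  k != 0 -> (t - k%:A) * (t - k^-1%:A) = 0 ->
  ((k + k^-1)%:A - t) * t = 1 /\ t * ((k + k^-1)%:A - t) = 1.
Proof.
move=> kN; rewrite mulrBr !mulrBl -!scalerAr -!scalerAl !mulr1 !mul1r scalerA.
rewrite mulVf // scale1r => e.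
suff h : (k + k^-1) *: t - t * t = 1.
  by split; rewrite ?mulrBl ?mulrBr -?scalerAl -?scalerAr ?mulr1 ?mul1r.
have -> : t * t = k *: t + (k^-1 *: t - 1).
  by rewrite addrC; apply/eqP; rewrite -subr_eq -subr_eq0; apply/eqP; exact: e.
by rewrite scalerDl opprD addrACA subrr add0r opprB addrC subrK.
Qed.

(* T0v and T1v stand for the generators with a check mark. *)
Inductive daha_gen := T0 | T1 | T0v | T1v.

Definition daha_gen_code (g : daha_gen) : bool * bool :=
  match g with
  | T0 => (false, false) | T1 => (false, true)
  | T0v => (true, false) | T1v => (true, true)
  end.
Definition daha_gen_decode (c : bool * bool) : daha_gen :=
  match c with
  | (false, false) => T0 | (false, true) => T1
  | (true, false) => T0v | (true, true) => T1v
  end.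
Lemma daha_gen_codeK : cancel daha_gen_code daha_gen_decode.
Proof. by case. Qed.
HB.instance Definition _ := Choice.copy daha_gen (can_type daha_gen_codeK).

Section DahaRelations.
Variables (F : fieldType) (k0 k1 k0v k1v q : F).
Local Notation X := (@free_gen F daha_gen).

Definition quad_rel (k : F) (a : free_alg F daha_gen) :=
  (a - k%:A) * (a - k^-1%:A).

Inductive daha_rel : free_alg F daha_gen -> Prop :=
| daha_rel_T0 : daha_rel (quad_rel k0 (X T0))
| daha_rel_T1 : daha_rel (quad_rel k1 (X T1))
| daha_rel_T0v : daha_rel (quad_rel k0v (X T0v))
| daha_rel_T1v : daha_rel (quad_rel k1v (X T1v))
| daha_rel_prod : daha_rel (X T0v * X T0 * X T1v * X T1 - q^-1%:A).

End DahaRelations.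

(* The ideal of relations is proper. The free algebra acts on functions       *)
(* K -> K, for an extension K of F with a point outside F, by difference-     *)
(* reflection operators: T1 reflects at z |-> z^-1, T0 at                     *)
(* z |-> q^-2 z^-1, and T1v T1, T0v T0 are multiplication by z, q^-1 z^-1.    *)
(* Only values at points outside F matter, where no denominator vanishes.     *)
Section DahaNontrivial.
Variables (F K : fieldType) (emb : {rmorphism F -> K}).
Variables (k0 k1 k0v k1v q : F).
Hypotheses (k0N : k0 != 0) (k1N : k1 != 0) (k0vN : k0v != 0) (k1vN : k1v != 0).
Hypothesis qN : q != 0.
Variable pt : K.
Hypothesis ptP : forall c, pt != emb c.

Local Notation good z := (forall c, z != emb c).

Definition ds (a b : K) (Y s : K -> K) (f : K -> K) (z : K) : K :=
  b * f (s z) + ((b + b^-1) * Y z - (a + a^-1)) * (f z - f (s z))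
                / (Y z - (Y z)^-1).
Definition dsv a b Y s (f : K -> K) (z : K) : K :=
  Y z * ((b + b^-1) * f z - ds a b Y s f z).

Let Y1 (z : K) := z.
Let s1 (z : K) := z^-1.
Let Y0 (z : K) := (emb q)^-1 * z^-1.
Let s0 (z : K) := (emb q)^-1 ^+ 2 * z^-1.

Definition daha_op (g : daha_gen) : (K -> K) -> K -> K :=
  match g with
  | T0 => ds (emb k0v) (emb k0) Y0 s0
  | T1 => ds (emb k1v) (emb k1) Y1 s1
  | T0v => dsv (emb k0v) (emb k0) Y0 s0
  | T1v => dsv (emb k1v) (emb k1) Y1 s1
  end.

Let embN c : c != 0 -> emb c != 0. Proof. by rewrite fmorph_eq0. Qed.

Lemma good_neq0 z : good z -> z != 0.
Proof. by move=> /(_ 0); rewrite rmorph0. Qed.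

Lemma good_inv z : good z -> good (z^-1).
Proof.
move=> gz c; apply: contra (gz c^-1) => /eqP e.
by rewrite fmorphV -e invrK.
Qed.

Lemma good_scale d z : d != 0 -> good z -> good (emb d * z).
Proof.
move=> dN gz c; apply: contra (gz (d^-1 * c)) => /eqP e.
by rewrite rmorphM fmorphV -e mulKf // embN.
Qed.

Lemma good_s1 z : good z -> good (s1 z). Proof. exact: good_inv. Qed.
Lemma good_s0 z : good z -> good (s0 z).
Proof.
move=> gz; rewrite /s0 -fmorphV -rmorphXn; apply: good_scale.
  by rewrite expf_neq0 // invr_neq0.
exact: good_inv.
Qed.
Lemma good_Y0 z : good z -> good (Y0 z).
Proof.
move=> gz; rewrite /Y0 -fmorphV; apply: good_scale; first by rewrite invr_neq0.
exact: good_inv.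
Qed.

Lemma good_sqr z : good z -> z ^+ 2 - 1 != 0.
Proof.
move=> gz; rewrite -[1](expr1n K 2) subr_sqr mulf_neq0 //.
  by have := gz 1; rewrite rmorph1 subr_eq0.
by have := gz (-1); rewrite rmorphN1 addr_eq0.
Qed.

(* ds satisfies its quadratic relation, and dsv ds is multiplication by Y *)
Section Pair.
Variables (a b : K) (Y s : K -> K).
Hypotheses (aN : a != 0) (bN : b != 0).
Hypothesis goodY : forall z, good z -> good (Y z).
Hypothesis sK : involutive s.
Hypothesis Ys : forall z, Y (s z) = (Y z)^-1.

Lemma ds_quad f z : good z ->
  ds a b Y s (ds a b Y s f) z = (b + b^-1) * ds a b Y s f z - f z.
Proof.
move=> gz; rewrite /ds sK Ys invrK.
have y0 := good_neq0 (goodY gz); have y2 := good_sqr (goodY gz).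
by field; rewrite y0 aN bN mulNr -expr2 y2 -oppr_eq0 opprB y2.
Qed.

Lemma dsv_ds f z : good z -> dsv a b Y s (ds a b Y s f) z = Y z * f z.
Proof. by move=> gz; rewrite /dsv ds_quad // opprB addrC subrK. Qed.

Lemma dsv_quad f z : good z ->
  dsv a b Y s (dsv a b Y s f) z = (a + a^-1) * dsv a b Y s f z - f z.
Proof.
move=> gz; rewrite /dsv /ds sK Ys invrK.
have y0 := good_neq0 (goodY gz); have y2 := good_sqr (goodY gz).
by field; rewrite y0 aN bN mulNr -expr2 y2 -oppr_eq0 opprB y2.
Qed.
End Pair.

Let K1 : involutive s1. Proof. exact: invrK. Qed.
Let K0 : involutive s0.
Proof.
move=> z; rewrite /s0 invfM invrK mulrA mulfV ?mul1r //.
by apply/expf_neq0; rewrite invr_eq0; apply: embN.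
Qed.
Let YS0 z : Y0 (s0 z) = (Y0 z)^-1.
Proof.
rewrite /Y0 /s0 !(expr2, invfM, invrK) !mulrA mulVf ?mul1r //.
exact: embN.
Qed.

Definition daha_param g :=
  match g with T0 => k0 | T1 => k1 | T0v => k0v | T1v => k1v end.

Lemma daha_op_rel g f z : good z ->
  daha_op g (daha_op g f) z =
  emb (daha_param g + (daha_param g)^-1) * daha_op g f z - f z.
Proof.
rewrite rmorphD fmorphV; case: g => gz.
- by apply: ds_quad => //; [exact: embN | exact: embN | exact: good_Y0].
- by apply: ds_quad => //; exact: embN.
- by apply: dsv_quad => //; [exact: embN | exact: embN | exact: good_Y0].
- by apply: dsv_quad => //; exact: embN.
Qed.

Lemma daha_op_prod f z : good z ->
  daha_op T0v (daha_op T0 (daha_op T1v (daha_op T1 f))) z = emb q^-1 * f z.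
Proof.
move=> gz; rewrite /= dsv_ds //; [|exact: embN|exact: embN|exact: good_Y0].
rewrite dsv_ds //; [|exact: embN|exact: embN].
by rewrite /Y0 /Y1 fmorphV mulrA mulrVK // unitfE good_neq0.
Qed.

Lemma daha_op_lin g c (f h : K -> K) z :
  daha_op g (fun w => c * f w + h w) z = c * daha_op g f z + daha_op g h z.
Proof. by case: g; rewrite /= /dsv /ds; ring. Qed.

Lemma daha_op_local g (f h : K -> K) :
  (forall z, good z -> f z = h z) ->
  forall z, good z -> daha_op g f z = daha_op g h z.
Proof.
move=> e z gz; have e1 := e _ (good_s1 gz); have e0 := e _ (good_s0 gz).
by case: g; rewrite /= /dsv /ds (e _ gz) ?e0 ?e1.
Qed.

Definition word_op (w : seq daha_gen) (f : K -> K) : K -> K :=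
  foldr daha_op f w.

Lemma word_op_lin w c (f h : K -> K) :
  word_op w (fun z => c * f z + h z) =
  (fun z => c * word_op w f z + word_op w h z).
Proof.
elim: w => //= g w ->; apply/funext => z; exact: daha_op_lin.
Qed.

Lemma word_op0 w : word_op w (fun=> 0) = (fun=> 0).
Proof.
have := word_op_lin w (-1) (fun=> 0) (fun=> 0).
have -> : (fun z : K => -1 * 0 + 0 : K) = (fun=> 0).
  by apply/funext => z; rewrite mulr0 addr0.
by move=> ->; apply/funext => z; rewrite mulN1r addNr.
Qed.

Lemma word_op_local w (f h : K -> K) :
  (forall z, good z -> f z = h z) ->
  forall z, good z -> word_op w f z = word_op w h z.
Proof. by move=> e; elim: w => //= g w IH; apply: daha_op_local. Qed.

Definition daha_act (a : free_alg F daha_gen) (f : K -> K) (z : K) : K :=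
  mmap emb (fun w : fmonom daha_gen => word_op w f z) a.

Lemma daha_actB a b f z : daha_act (a - b) f z = daha_act a f z - daha_act b f z.
Proof. exact: mmapB. Qed.

Lemma daha_actU c w f z : daha_act << c *g w >> f z = emb c * word_op w f z.
Proof. exact: mmapU. Qed.

Lemma daha_actE a f :
  daha_act a f = (fun z => \sum_(w <- msupp a) emb a@_w * word_op w f z).
Proof. by apply/funext => z; rewrite /daha_act mmapE. Qed.

Lemma word_op_sum w (s : seq (fmonom daha_gen)) (c : fmonom daha_gen -> K) f z :
  word_op w (fun y => \sum_(v <- s) c v * word_op v f y) z =
  \sum_(v <- s) c v * word_op w (word_op v f) z.
Proof.
elim: s => [|v s IH].
  rewrite big_nil (_ : (fun y => _) = (fun=> 0)) ?word_op0 //.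
  by apply/funext => y; rewrite big_nil.
rewrite big_cons -IH (_ : (fun y => _) =
  (fun y => c v * word_op v f y + \sum_(v <- s) c v * word_op v f y)).
  by rewrite word_op_lin.
by apply/funext => y; rewrite big_cons.
Qed.

Lemma daha_actM a b f z : daha_act (a * b) f z = daha_act a (daha_act b f) z.
Proof.
rewrite malgME [RHS]/daha_act mmapE /daha_act raddf_sum.
apply: eq_bigr => w _; rewrite raddf_sum -/(daha_act b f) daha_actE word_op_sum.
rewrite mulr_sumr; apply: eq_bigr => v _.
rewrite /= mmapU.
transitivity (emb (a@_w * b@_v) * word_op (mmul w v) f z); first by [].
rewrite rmorphM -mulrA; congr (_ * (_ * _)).
by rewrite [mmul w v]fmmulE /= /word_op foldr_cat.
Qed.

Lemma daha_act_gen g f : daha_act (@free_gen F _ g) f = daha_op g f.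
Proof. by apply/funext => z; rewrite daha_actU rmorph1 mul1r fmuE. Qed.

Lemma daha_actA c f z : daha_act c%:A f z = emb c * f z.
Proof.
have -> : (c%:A : free_alg F daha_gen) = << c *g fmone _ >>.
  by rewrite -[c%:A]mul_malgC mulr1.
by rewrite daha_actU fmoneE.
Qed.

Lemma daha_act_rel r : daha_rel k0 k1 k0v k1v q r ->
  forall f z, good z -> daha_act r f z = 0.
Proof.
have quad g f z : good z ->
    daha_act (quad_rel (daha_param g) (@free_gen F _ g)) f z = 0.
  have gN : daha_param g != 0 by case: g.
  move=> gz; rewrite daha_actM daha_actB daha_actA.
  have -> : daha_act (@free_gen F _ g - (daha_param g)^-1%:A) f =
      (fun y => - emb (daha_param g)^-1 * f y + daha_op g f y).
    apply/funext => y; rewrite daha_actB daha_actA daha_act_gen.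
    by rewrite mulNr addrC.
  rewrite daha_act_gen daha_op_lin daha_op_rel // rmorphD fmorphV.
  by have pN := embN gN; field.
case=> f z gz; first exact: (quad T0).
- exact: (quad T1).
- exact: (quad T0v).
- exact: (quad T1v).
by rewrite daha_actB daha_actA !daha_actM !daha_act_gen daha_op_prod // subrr.
Qed.

Lemma daha_act_local a (f h : K -> K) :
  (forall z, good z -> f z = h z) ->
  forall z, good z -> daha_act a f z = daha_act a h z.
Proof.
move=> e z gz; rewrite !daha_actE; apply: eq_bigr => w _.
by rewrite (word_op_local w e).
Qed.

Lemma daha_ideal_act a : ideal_gen (daha_rel k0 k1 k0v k1v q) a ->
  forall f z, good z -> daha_act a f z = 0.
Proof.
elim=> [a' r b Sr||u v _ hu _ hv] f z gz.
- rewrite !daha_actM.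
  rewrite (@daha_act_local _ _ (fun=> 0)) // => [|y gy].
    by rewrite daha_actE big1 // => w _; rewrite word_op0 mulr0.
  exact: daha_act_rel.
- exact: mmap0.
- by rewrite daha_actB hu // hv // subr0.
Qed.

Lemma daha_ideal_proper_of_ext : ~ ideal_gen (daha_rel k0 k1 k0v k1v q) 1.
Proof.
move=> /daha_ideal_act/(_ (fun=> 1) pt ptP).
rewrite -(scale1r 1) daha_actA rmorph1 mulr1 => /eqP.
by rewrite oner_eq0.
Qed.

End DahaNontrivial.

Lemma daha_ideal_proper (F : fieldType) (k0 k1 k0v k1v q : F) :
  k0 != 0 -> k1 != 0 -> k0v != 0 -> k1v != 0 -> q != 0 ->
  ~ ideal_gen (daha_rel k0 k1 k0v k1v q) 1.
Proof.
move=> h0 h1 h0v h1v hq.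
pose emb : {rmorphism F -> {fraction {poly F}}} := @tofrac {poly F} \o polyC.
apply: (@daha_ideal_proper_of_ext F _ emb _ _ _ _ _ h0 h1 h0v h1v hq (tofrac 'X)).
move=> c; rewrite /emb /= tofrac_eq; apply/eqP => /(congr1 (size : {poly F} -> nat)).
by rewrite size_polyX size_polyC; case: (c != 0).
Qed.

Section Daha.
Variables (F : fieldType) (k0 k1 k0v k1v q : F).
Hypotheses (k0N : k0 != 0) (k1N : k1 != 0) (k0vN : k0v != 0) (k1vN : k1v != 0).
Hypothesis qN : q != 0.

(* The algebra H(k0, k1, k0v, k1v; q); it takes the proofs that the scalars   *)
(* are nonzero because the algebra structures of the library require 1 != 0.  *)
Definition daha of k0 != 0 & k1 != 0 & k0v != 0 & k1v != 0 & q != 0 :=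
  alg_quot (daha_rel k0 k1 k0v k1v q).

Local Notation H := (daha k0N k1N k0vN k1vN qN).

HB.instance Definition _ := GRing.PzRing.on H.
HB.instance Definition _ := GRing.Lmodule.on H.
Fact daha_oner_neq0 : (1 : H) != 0.
Proof. exact/rq_one_neq0/daha_ideal_proper. Qed.
HB.instance Definition _ := GRing.PzSemiRing_isNonZero.Build H daha_oner_neq0.
HB.instance Definition _ := GRing.Lmodule_isLalgebra.Build F H
  (@aq_scaleAl _ _ _).
HB.instance Definition _ := GRing.Lalgebra_isAlgebra.Build F H
  (@aq_scaleAr _ _ _).

HB.instance Definition _ := GRing.NzRing_hasMulInverse.Build H
  (@cl_mulVr H) (@cl_divrr H) (@cl_unitrP H) (@cl_invr_out H).

Definition daha_t (g : daha_gen) : H :=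
  rq_pi (daha_rel k0 k1 k0v k1v q) (free_gen F g).

Lemma daha_t_quad g :
  (daha_t g - (daha_param k0 k1 k0v k1v g)%:A)
    * (daha_t g - (daha_param k0 k1 k0v k1v g)^-1%:A) = 0.
Proof.
by apply: aq_quad; case: g;
  [exact: daha_rel_T0|exact: daha_rel_T1|exact: daha_rel_T0v|exact: daha_rel_T1v].
Qed.

Lemma daha_t_prod :
  daha_t T0v * daha_t T0 * daha_t T1v * daha_t T1 = q^-1%:A.
Proof.
exact: (aq_prod4 (daha_rel_prod k0 k1 k0v k1v q)).
Qed.

Lemma daha_param_neq0 g : daha_param k0 k1 k0v k1v g != 0.
Proof. by case: g. Qed.

Lemma daha_t_unit g : daha_t g \is a GRing.unit.
Proof.
by apply/unitrP; eexists; apply: quad_inv (daha_param_neq0 g) (daha_t_quad g).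
Qed.

Lemma daha_t_addV g :
  daha_t g + (daha_t g)^-1 =
  (daha_param k0 k1 k0v k1v g + (daha_param k0 k1 k0v k1v g)^-1)%:A.
Proof.
have [_ e] := quad_inv (daha_param_neq0 g) (daha_t_quad g).
have -> : (daha_t g)^-1 = (daha_param k0 k1 k0v k1v g
    + (daha_param k0 k1 k0v k1v g)^-1)%:A - daha_t g.
  by apply: (mulrI (daha_t_unit g)); rewrite mulrV ?daha_t_unit.
by rewrite addrC subrK.
Qed.

End Daha.

(* Main.v *)
(** Let [a b c d = q^-1] with [a + a^-1 = al], [b + b^-1 = be], [c + c^-1 = ga]
    and [d + d^-1] scalars, and let [x], [y], [z] be [ad], [cd], [bd] plus their
    inverses; all three commute with [d]. Everything follows from
      [q xy - q^-1 yx + (q^2 - q^-2) z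
        = (q - q^-1) (al ga + be (q^-1 d + q d^-1))],
    valid for every [q]: divide by [q - q^-1] or [q^2 - q^-2] when possible.
    Since [qb = a^-1 d^-1 c^-1], expanding [xy] gives
      [xy + qz + ac = al ga + dacd + q be d^-1].
    The hypotheses are stable under [(a, b, c, d, q) ->
    (c^-1, b^-1, a^-1, d^-1, q^-1)], which exchanges [x] and [y] and turns this
    into a formula for [yx]. In [q xy - q^-1 yx] the remaining cubic and quartic
    terms cancel because [be = q acd + q^-1 (acd)^-1], a conjugate of
    [b + b^-1]. Finally [(a, b, c, d) -> (b, c, d a d^-1, d)] preserves
    [abcd = q^-1] and permutes [x -> z -> y -> x]. *)
Require Import Defs.
From mathcomp Require Import all_boot all_order all_algebra.
From mathcomp Require Import ring.
Set Implicit Arguments.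
Unset Strict Implicit.
Unset Printing Implicit Defensive.
Import GRing.Theory.
Local Open Scope ring_scope.

Section InverseSums.
Variables (F : fieldType) (A : unitAlgType F).
Implicit Types (a b c d x y z r : A) (al be ga de q : F).

(** For [al = k + k^-1] this is the relation [(a - k)(a - k^-1) = 0], in a form invariant under
    [a -> a^-1]. *)
Definition has_trace al a := (a \is a GRing.unit) /\ a + a^-1 = al%:A.
Definition inv_sum a := a + a^-1.

Lemma has_traceV al a : has_trace al a -> has_trace al a^-1.
Proof. by case=> aU aE; split; rewrite ?unitrV // invrK addrC. Qed.

Lemma has_traceJ al a d : d \is a GRing.unit -> has_trace al a ->
  has_trace al (d * a * d^-1).
Proof.
move=> dU [aU aE]; split; first by rewrite !unitrMl ?unitrV.
rewrite !invrM ?unitrMl ?unitrV // invrK mulrA -mulrDl -mulrDr aE.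
by rewrite -scalerAr mulr1 -scalerAl mulrV.
Qed.

(** Substituting [a^-1 = al - a] reduces this to [(d + d^-1) a d = a (d + d^-1) d], which holds
    since [d + d^-1] is a scalar. *)
Lemma comm_inv_sum al de a d : has_trace al a -> has_trace de d ->
  d * inv_sum (a * d) = inv_sum (a * d) * d.
Proof.
move=> [aU aE] [dU dE]; rewrite /inv_sum invrM // mulrDr mulrDl mulVKr //.
have -> : a^-1 = al%:A - a by rewrite -aE addrAC subrr add0r.
rewrite mulrBr mulrBl -scalerAr mulr1 -scalerAl mulVr //.
rewrite !addrA ![_ + al%:A]addrC -!addrA; congr (_ + _).
apply/eqP; rewrite subr_eq addrAC -subr_eq opprK.
rewrite mulrA -!mulrDl dE -[X in _ == _ + X](mulrVK dU) -mulrDl -mulrDr dE.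
by rewrite -scalerAl mul1r -scalerAr mulr1.
Qed.

(** [d a] is the conjugate of [a d] by [d], which commutes with [inv_sum (a * d)]. *)
Lemma inv_sumC al de a d : has_trace al a -> has_trace de d ->
  inv_sum (d * a) = inv_sum (a * d).
Proof.
move=> ha hd; have [[aU _] [dU _]] := (ha, hd).
apply: (mulIr dU); rewrite -(comm_inv_sum ha hd) /inv_sum !invrM //.
by rewrite mulrDr mulrDl mulVKr // mulrVK // mulrA.
Qed.

Lemma inv_sumJ al de a d : has_trace al a -> has_trace de d ->
  inv_sum (d * a * d^-1 * d) = inv_sum (a * d).
Proof. by move=> ha hd; case: (hd) => dU _; rewrite mulrVK // (inv_sumC ha hd). Qed.

Lemma prod4_rot q a b c d : a \is a GRing.unit -> d \is a GRing.unit ->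
  a * b * c * d = q%:A -> b * c * (d * a * d^-1) * d = q%:A.
Proof.
move=> aU dU e; apply: (mulrI aU).
by rewrite !mulrA mulrVK // e -scalerAl mul1r -scalerAr mulr1.
Qed.

Lemma inv_sum_mulD al be ga de q a b c d : q != 0 ->
  has_trace al a -> has_trace be b -> has_trace ga c -> has_trace de d ->
  a * b * c * d = q^-1%:A ->
  inv_sum (a * d) * inv_sum (c * d) + q *: inv_sum (b * d) + a * c =
  (al * ga)%:A + d * a * c * d + (q * be) *: d^-1.
Proof.
move=> qN [aU aE] [bU bE] hc hd; have [[cU cE] [dU dE]] := (hc, hd).
move=> e.
have qb : q *: b = a^-1 * d^-1 * c^-1.
  apply: (mulrI aU); apply: (mulIr cU); apply: (mulIr dU).
  rewrite -scalerAr -!scalerAl e scalerA mulfV // scale1r.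
  by rewrite !mulrA mulrV // mul1r mulrVK // mulVr.
have -> : inv_sum (a * d) * inv_sum (c * d) =
    a * (inv_sum (c * d) * d) + d^-1 * a^-1 * inv_sum (c * d).
  by rewrite -(comm_inv_sum hc hd) {1}/inv_sum invrM // mulrDl !mulrA.
(* Replacing [b^-1] by [be - b] creates the term that cancels [d^-1 a^-1 d^-1 c^-1] in the product
   above. *)
have -> : q *: inv_sum (b * d) =
    a^-1 * d^-1 * c^-1 * d - d^-1 * a^-1 * d^-1 * c^-1 + (q * be) *: d^-1.
  rewrite /inv_sum invrM // scalerDr scalerAl qb -addrA; congr (_ + _).
  have -> : b^-1 = be%:A - b by rewrite -bE addrAC subrr add0r.
  rewrite mulrBr -scalerAr mulr1 scalerBr scalerA scalerAr qb addrC.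
  by rewrite !mulrA.
rewrite /inv_sum invrM //.
(* This rearranges [(d + d^-1) a c d = a c (d + d^-1) d], again because [d + d^-1] is a scalar. *)
have -> : d * a * c * d = a * c * d * d + a * c - d^-1 * a * c * d.
  have -> : a * c * d * d + a * c = a * c * (d + d^-1) * d.
    by rewrite mulrDr mulrDl mulrVK.
  rewrite dE -scalerAr mulr1 -[de *: (a * c)]mul1r -scalerAr scalerAl -dE.
  by rewrite -!mulrA -mulrBl [d + _]addrC addrAC subrr add0r !mulrA.
(* Start from [al d^-1 (c + c^-1) d]: the scalar [al] is expanded to the left of [d^-1] in the
   [c^-1] term and to its right in the [c] term, so that the words match the other side. *)
have -> : (al * ga)%:A = 
  a * d^-1 * c^-1 * d + a^-1 * d^-1 * c^-1 * d +
   d^-1 * a * c * d + d^-1 * a^-1 * c * d.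
  have -> : a * d^-1 * c^-1 * d + a^-1 * d^-1 * c^-1 * d =
      al *: (d^-1 * c^-1 * d).
    by rewrite -!mulrDl aE -!scalerAl mul1r.
  have e' : d^-1 * a * c * d + d^-1 * a^-1 * c * d = al *: (d^-1 * c * d).
    by rewrite -!mulrDl -mulrDr aE -scalerAr mulr1 -!scalerAl.
  rewrite -addrA e' -scalerDr -mulrDl -mulrDr addrC cE.
  by rewrite -scalerAr mulr1 -!scalerAl mulVr // scalerA.
rewrite !mulrDl !mulrDr !mulrA.
(* The parenthesised pairs cancel: [d^-1 a^-1 d^-1 c^-1] on the left, [d^-1 a c d] on the right. *)
rewrite !addrA [LHS](ACl (2*5*3*1*8*7*(4*6))) [RHS](ACl (1*2*4*5*6*8*(3*7))) /=.
by rewrite !subrr.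
Qed.

Lemma inv_sum_q_commutator al be ga de q a b c d : q != 0 ->
  has_trace al a -> has_trace be b -> has_trace ga c -> has_trace de d ->
  a * b * c * d = q^-1%:A ->
  let x := inv_sum (a * d) in let y := inv_sum (c * d) in
  let z := inv_sum (b * d) in
  q *: (x * y) - q^-1 *: (y * x) + (q ^+ 2 - q ^- 2) *: z =
  (q - q^-1) *: ((al * ga)%:A + be *: (q^-1 *: d + q *: d^-1)).
Proof.
move=> qN ha hb hc hd e x y z.
have [[[aU _] [bU bE]] [[cU _] [dU _]]] := ((ha, hb), (hc, hd)).
have dabc : d * a * b * c = q^-1%:A.
  by apply: (mulIr dU); rewrite -!mulrA [a * _]mulrA [a * b * _]mulrA e
    -scalerAr -scalerAl mulr1 mul1r.
have abd : d * a = q^-1 *: (c^-1 * b^-1).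
  apply: (mulIr bU); apply: (mulIr cU); rewrite dabc.
  by rewrite -!scalerAl mulrVK // mulVr.
have bda : a * b = q^-1 *: (d^-1 * c^-1).
  apply: (mulIr cU); apply: (mulIr dU); rewrite e.
  by rewrite -!scalerAl mulrVK // mulVr.
(* Inverting the letters keeps all three sums, as [a^-1 d^-1] is the inverse of [d a]. *)
have hx : inv_sum (a^-1 * d^-1) = x.
  by rewrite /x -(inv_sumC ha hd) /inv_sum -!invrM // invrK addrC.
have hy : inv_sum (c^-1 * d^-1) = y.
  by rewrite /y -(inv_sumC hc hd) /inv_sum -!invrM // invrK addrC.
have hz : inv_sum (b^-1 * d^-1) = z.
  by rewrite /z -(inv_sumC hb hd) /inv_sum -!invrM // invrK addrC.
have e1 := inv_sum_mulD qN ha hb hc hd e.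
have /(inv_sum_mulD _ (has_traceV hc) (has_traceV hb) (has_traceV ha) (has_traceV hd)) :
    c^-1 * b^-1 * a^-1 * d^-1 = q^-1^-1%:A.
  apply: (mulIr dU); apply: (mulIr aU); rewrite mulrVK // mulrVK // -scalerAl mul1r.
  by rewrite -scalerAl abd scalerA mulVf ?invr_eq0 // scale1r.
rewrite invr_eq0 hx hy hz invrK => /(_ qN) e2.
set w := c^-1 * a^-1.
(* Since [a b = q^-1 d^-1 c^-1], the conjugate [a b a^-1] equals [q^-1 (a c d)^-1]. *)
have beE : be%:A = q *: (a * c * d) + q^-1 *: (d^-1 * w).
  have [_ <-] := has_traceJ aU hb.
  rewrite bda -!scalerAl -mulrA invrZ ?unitrMl ?unitrV ?unitfE ?invr_eq0 //.
  by rewrite !invrM ?unitrMl ?unitrV // !invrK addrC /w !mulrA.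
(* With [bedV], this collapses the words left over in the q-commutator to [be *: (d - d^-1)]. *)
have bed : be *: d = q *: (d * a * c * d) + q^-1 *: w.
  rewrite -[d in LHS]mulr1 scalerAr beE mulrDr -!scalerAr mulVKr //.
  by rewrite !mulrA.
have bedV : be *: d^-1 = q *: (a * c) + q^-1 *: (d^-1 * w * d^-1).
  by rewrite -[d^-1 in LHS]mul1r scalerAl beE mulrDl -!scalerAl mulrK.
have f1 : q *: (x * y) + q ^+ 2 *: z + q *: (a * c) =
    q *: ((al * ga)%:A + d * a * c * d + (q * be) *: d^-1).
  by rewrite -e1 [RHS]scalerDr [X in _ = X + _]scalerDr scalerA.
have f2 : q^-1 *: (y * x) + q ^- 2 *: z + q^-1 *: w =
    q^-1 *: ((al * ga)%:A + d^-1 * w * d^-1 + (q^-1 * be) *: d).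
  by rewrite /w mulrA [al * _]mulrC -e2 [RHS]scalerDr [X in _ = X + _]scalerDr scalerA -exprVn.
rewrite scalerBl addrACA -opprD.
rewrite -[X in X - _](addrK (q *: (a * c))) f1.
rewrite -[X in _ - X](addrK (q^-1 *: w)) f2.
transitivity ((q - q^-1) *: (al * ga)%:A
  + (q *: (d * a * c * d) + q^-1 *: w)
  - (q *: (a * c) + q^-1 *: (d^-1 * w * d^-1))
  + (q ^+ 2 *: (be *: d^-1) - q ^- 2 *: (be *: d))).
  rewrite scalerBl !scalerDr !scalerA -exprVn !expr2 !mulrA !opprD !opprK !addrA.
  by rewrite [LHS](ACl (1*5*2*8*4*6*3*7)).
rewrite -bed -bedV scalerDr -!addrA; congr (_ + _).
rewrite !scalerDr !scalerA !addrA.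
rewrite [LHS](ACl (1*4*(2*3))) /= -!scaleNr -!scalerDl.
congr (_ *: _ + _ *: _); by field.
Qed.

(** Here [q^-1 = q], so the [z] term and the right side vanish. *)
Lemma q_commutator_sqr1 q x y z r : q != 0 -> q ^+ 2 = 1 ->
  q *: (x * y) - q^-1 *: (y * x) + (q ^+ 2 - q ^- 2) *: z =
    (q - q^-1) *: r ->
  x * y = y * x.
Proof.
move=> qN q2; have -> : q^-1 = q by apply: (mulfI qN); rewrite mulfV // -expr2 q2.
rewrite q2 invr1 !subrr !scale0r addr0 -scalerBr => /eqP.
by rewrite scaler_eq0 (negPf qN) subr_eq0 => /eqP.
Qed.

(** Here [q^-1 = - q]: the [z] term vanishes and [q (xy + yx) = 2 q r] remains. *)
Lemma q_commutator_sqrN1 q x y z r : q ^+ 2 = -1 -> 2 != 0 :> F ->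
  q *: (x * y) - q^-1 *: (y * x) + (q ^+ 2 - q ^- 2) *: z =
    (q - q^-1) *: r ->
  2^-1 *: (x * y + y * x) = r.
Proof.
move=> q2 n2; have qN : q != 0.
  by apply/eqP => q0; move: q2 (oner_neq0 F); rewrite q0 expr0n /= => /eqP;
    rewrite eq_sym oppr_eq0 => ->.
have -> : q^-1 = - q by apply: (mulfI qN); rewrite mulfV // mulrN -expr2 q2 opprK.
rewrite q2 invrN1 subrr scale0r addr0 scaleNr !opprK -scalerDr.
rewrite (_ : q + q = q * 2); last by ring.
by rewrite -scalerA => /(scalerI qN) ->; rewrite scalerA mulVf // scale1r.
Qed.

Lemma q_commutator_generic q x y z r : q != 0 -> q ^+ 4 != 1 ->
  q *: (x * y) - q^-1 *: (y * x) + (q ^+ 2 - q ^- 2) *: z =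
    (q - q^-1) *: r ->
  (q ^+ 2 - q ^- 2)^-1 *: (q *: (x * y) - q^-1 *: (y * x)) + z =
    (q + q^-1)^-1 *: r.
Proof.
move=> qN q4 e.
have : q ^+ 4 - 1 != 0 by rewrite subr_eq0.
rewrite (_ : q ^+ 4 - 1 = (q ^+ 2 - 1) * (q ^+ 2 + 1)); last by ring.
rewrite mulf_eq0 negb_or => /andP[qB qD].
have DN : q ^+ 2 - q ^- 2 != 0.
  have -> : q ^+ 2 - q ^- 2 = (q ^+ 2 - 1) * (q ^+ 2 + 1) * q ^- 2 by field.
  by rewrite !mulf_neq0 ?invr_eq0 ?expf_neq0.
apply: (scalerI DN); rewrite scalerDr scalerA mulfV // scale1r e scalerA.
congr (_ *: _); field.
by rewrite qN -expr2 qD.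
Qed.
End InverseSums.

Theorem theorem2p4 (F : fieldType) (k0 k1 k0v k1v q : F)
    (k0N : k0 != 0) (k1N : k1 != 0) (k0vN : k0v != 0) (k1vN : k1v != 0)
    (qN : q != 0) :
  let H := daha k0N k1N k0vN k1vN qN in
  let t0 : H := daha_t k0N k1N k0vN k1vN qN T0 in
  let t1 : H := daha_t k0N k1N k0vN k1vN qN T1 in
  let t0v : H := daha_t k0N k1N k0vN k1vN qN T0v in
  let t1v : H := daha_t k0N k1N k0vN k1vN qN T1v in
  let x : H := t0v * t1 + (t0v * t1)^-1 in
  let y : H := t1v * t1 + (t1v * t1)^-1 in
  let z : H := t0 * t1 + (t0 * t1)^-1 in
  let s0 := k0 + k0^-1 in
  let s0v := k0v + k0v^-1 in
  let s1v := k1v + k1v^-1 in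
  let T : H := q^-1 *: t1 + q *: t1^-1 in
  [/\ [/\ t1 * x = x * t1, t1 * y = y * t1 & t1 * z = z * t1],
      q ^+ 2 = 1 -> [/\ x * y = y * x, y * z = z * y & z * x = x * z],
      q ^+ 2 != 1 -> q ^+ 4 = 1 ->
        [/\ 2%N \notin [pchar F],
            2^-1 *: (x * y + y * x) = (s0v * s1v)%:A + s0 *: T,
            2^-1 *: (y * z + z * y) = (s1v * s0)%:A + s0v *: T
          & 2^-1 *: (z * x + x * z) = (s0 * s0v)%:A + s1v *: T]
    & q ^+ 4 != 1 ->
        [/\ (q ^+ 2 - q ^- 2)^-1 *: (q *: (x * y) - q^-1 *: (y * x)) + z
              = (q + q^-1)^-1 *: ((s0v * s1v)%:A + s0 *: T),
            (q ^+ 2 - q ^- 2)^-1 *: (q *: (y * z) - q^-1 *: (z * y)) + x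
              = (q + q^-1)^-1 *: ((s1v * s0)%:A + s0v *: T)
          & (q ^+ 2 - q ^- 2)^-1 *: (q *: (z * x) - q^-1 *: (x * z)) + y
              = (q + q^-1)^-1 *: ((s0 * s0v)%:A + s1v *: T)]].
Proof.
move=> H t0 t1 t0v t1v x y z s0 s0v s1v T.
have tr g : has_trace (daha_param k0 k1 k0v k1v g
    + (daha_param k0 k1 k0v k1v g)^-1) (daha_t k0N k1N k0vN k1vN qN g).
  by split; [exact: daha_t_unit | exact: daha_t_addV].
have h0 : has_trace s0 t0 := tr T0.
have h1 : has_trace (k1 + k1^-1) t1 := tr T1.
have h0v : has_trace s0v t0v := tr T0v.
have h1v : has_trace s1v t1v := tr T1v.
have e : t0v * t0 * t1v * t1 = q^-1%:A := daha_t_prod _ _ _ _ _.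
have [[[t0U _] [t1U _]] [t0vU _]] := (h0, h1, h0v).
(* One rotation yields the relation for [z], [x], and two yield that for [y], [z]; [inv_sumJ]
   removes the conjugations by [t1]. *)
have e' := prod4_rot t0vU t1U e.
have e'' := prod4_rot t0U t1U e'.
have h0v' := has_traceJ t1U h0v.
have h0' := has_traceJ t1U h0.
have Mxy : q *: (x * y) - q^-1 *: (y * x) + (q ^+ 2 - q ^- 2) *: z =
  (q - q^-1) *: ((s0v * s1v)%:A + s0 *: T) := inv_sum_q_commutator qN h0v h0 h1v h1 e.
have := inv_sum_q_commutator qN h0 h1v h0v' h1 e'.
rewrite /= (inv_sumJ h0v h1) => Mzx.
have := inv_sum_q_commutator qN h1v h0v' h0' h1 e''.
rewrite /= (inv_sumJ h0v h1) (inv_sumJ h0 h1) => Myz.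
split.
- by split; [exact: comm_inv_sum h0v h1|exact: comm_inv_sum h1v h1|
    exact: comm_inv_sum h0 h1].
- move=> q2; split.
  + exact: q_commutator_sqr1 Mxy.
  + exact: q_commutator_sqr1 Myz.
  + exact: q_commutator_sqr1 Mzx.
- move=> q2 q4; have q2N : q ^+ 2 = -1.
    have := subr_sqr (q ^+ 2) 1; rewrite -exprM q4 expr1n subrr => /esym/eqP.
    by rewrite mulf_eq0 subr_eq0 (negPf q2) addr_eq0 => /eqP.
  (* In characteristic 2, [q ^+ 2 = -1] would be [1]. *)
  have n2 : 2 != 0 :> F.
    apply: contra q2 => /eqP n2; rewrite q2N eq_sym.
    by rewrite -subr_eq0 opprK -mulr2n n2.
  split; first by rewrite inE /= n2.
  + exact: q_commutator_sqrN1 Mxy.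
  + exact: q_commutator_sqrN1 Myz.
  + exact: q_commutator_sqrN1 Mzx.
- move=> q4; split.
  + exact: (q_commutator_generic qN q4 Mxy).
  + exact: (q_commutator_generic qN q4 Myz).
  + exact: (q_commutator_generic qN q4 Mzx).
Qed.
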